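(* Let $X,Y,M$ be real-valued random variables on $(\Omega,\mathcal{F},\mathbb{P})$ with $M\sim\mu$, let $\mathcal{N}$ be the Stein operator associated with $\mu$, let $\tilde{\mathcal{H}}$ be a separating class of test functions on $\mathbb{R}^2$, and let $\tilde{\mathcal{E}}$ be a class of functions containing, for every $h\in\tilde{\mathcal{H}}$, the solution $f_h$ of the Stein equation $$\mathcal{N} f_h(x,y)=h(x,y)-\mathbb{E}[h(M,y)],\qquad x,y\in\mathbb{R}$$ (with $\tilde{\mathcal{H}}$, $\tilde{\mathcal{E}}$ and this equation as specified in the context). Assume that $\|\mathcal{N} f\|_{\infty}=\sup_{(x,y)\in\mathbb{R}^2}|\mathcal{N} f(x,y)|<\infty$ for all $f\in\tilde{\mathcal{E}}$. Then $$ X\sim\mu \ \text{ and } X,Y \text{ are independent} \iff \mathbb{E}[\mathcal{N} f(X,Y)]=0 \ \text{ for all } f\in\tilde{\mathcal{E}}. $$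
   Context: $(\Omega,\mathcal{F},\mathbb{P})$ is a probability space and $\mu$ is a probability measure on $\mathbb{R}$. $\mathcal{C}$ is a class of functions $f:\mathbb{R}\to\mathbb{R}$, and $\mathcal{N}$ (the Stein operator for $\mu$) is an operator assigning to each $f\in\mathcal{C}$ a Borel-measurable function $\mathcal{N} f:\mathbb{R}\to\mathbb{R}$, such that: (i) for any $\mathbb{R}$-valued random variable $X$ on $(\Omega,\mathcal{F},\mathbb{P})$: $X\sim\mu$ if and only if $\mathbb{E}[\mathcal{N} f(X)]=0$ for all $f\in\mathcal{C}$ (the equality including integrability of $\mathcal{N} f(X)$); (ii) for every bounded Borel-measurable $h:\mathbb{R}\to\mathbb{R}$, the Stein equation $\mathcal{N} f(x)=h(x)-\mathbb{E}[h(M)]$, $x\in\mathbb{R}$, has a solution $f\in\mathcal{C}$. $\tilde{\mathcal{C}}$ denotes the class of functions $f:\mathbb{R}\times\mathbb{R}\to\mathbb{R}$ such that $f(\cdot,y)\in\mathcal{C}$ for all $y\in\mathbb{R}$. In $\mathcal{N} f(x,y)$ the operator acts only on the first argument: $\mathcal{N} f(x,y)=(\mathcal{N} f(\cdot,y))(x)$. Test functions: $\mathcal{H}$ is a class of Borel-measurable functions $g:\mathbb{R}\to\mathbb{R}$ with $\mathbb{E}|g(M)|<\infty$ for which the Stein equation $\mathcal{N} f=g-\mathbb{E}[g(M)]$ has a unique solution $f\in\mathcal{C}$. $\tilde{\mathcal{H}}$ is a class of Borel-measurable functions $h:\mathbb{R}\times\mathbb{R}\to\mathbb{R}$, integrable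 with respect to $\mathbb{P}_M\otimes\mathbb{P}_Y$ (the product of the laws of $M$ and $Y$), such that for every $y\in\mathbb{R}$ the function $h_y(x)=h(x,y)$ belongs to $\mathcal{H}$. $\tilde{\mathcal{H}}$ is assumed separating on $\mathbb{R}^2$: if $P,Q$ are Borel probability measures on $\mathbb{R}^2$ with respect to which every $h\in\tilde{\mathcal{H}}$ is integrable and $\int h\,dP=\int h\,dQ$ for all $h\in\tilde{\mathcal{H}}$, then $P=Q$. For $h\in\tilde{\mathcal{H}}$ and $y\in\mathbb{R}$, let $f_{y,h}\in\mathcal{C}$ be the unique solution of $\mathcal{N} f_{y,h}(x)=h(x,y)-\mathbb{E}[h(M,y)]$, $x\in\mathbb{R}$, and set $f_h(x,y)=f_{y,h}(x)$; here $\mathbb{E}[h(M,y)]$ is computed for fixed $y$. $\tilde{\mathcal{E}}$ is a class of functions $f\in\tilde{\mathcal{C}}$ with $\mathcal{N} f$ Borel-measurable on $\mathbb{R}^2$, which contains $f_h$ for every $h\in\tilde{\mathcal{H}}$ (and possibly more functions). *)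

(* Defs.v *)
From HB Require Import structures.
From mathcomp Require Import all_boot all_order all_algebra.
From mathcomp Require Import all_classical all_reals all_analysis.

Set Implicit Arguments.
Unset Strict Implicit.
Unset Printing Implicit Defensive.

Import Order.TTheory GRing.Theory Num.Theory.
Import numFieldNormedType.Exports.

Local Open Scope classical_set_scope.
Local Open Scope ring_scope.
Local Open Scope ereal_scope.

Section stein.
Context {d : measure_display} {Omega : measurableType d} {R : realType}.
Variable P : probability Omega R.

Implicit Types (mu : probability (measurableTypeR R) R).
Implicit Types (X Y M : {RV P >-> measurableTypeR R}).
(* A Stein operator is only meaningful on its class C; N is a total function
   whose values outside C are never used. *)
Implicit Types (C H : set (R -> R)) (N : (R -> R) -> (R -> R)).

(* Measures are compared on measurable sets only: the value of the set function
   underlying a measure on other sets is irrelevant. *)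
Definition has_law X mu :=
  forall A : set (measurableTypeR R), measurable A -> distribution P X A = mu A.

Definition independent_RV X Y :=
  forall A B : set (measurableTypeR R), measurable A -> measurable B ->
    P (X @^-1` A `&` Y @^-1` B) = P (X @^-1` A) * P (Y @^-1` B).

(* N f = g - E[g(M)]; stated in \bar R, so that a solution exists only
   when E[g(M)] is finite. *)
Definition stein_solution M C N (g f : R -> R) :=
  C f /\ forall x : R, (N f x)%:E = (g x)%:E - 'E_P[g \o M].

Record stein_operator mu M C N : Prop := {
  stein_measurable : forall f, C f ->
    measurable_fun [set: measurableTypeR R] (N f : _ -> measurableTypeR R) ;
  stein_characterization : forall X, has_law X mu <->
    (forall f, C f ->
       P.-integrable [set: Omega] (EFin \o (N f \o X)) /\ 'E_P[N f \o X] = 0) ;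
  stein_solvable : forall h : R -> R,
    measurable_fun [set: measurableTypeR R] (h : _ -> measurableTypeR R) ->
    (exists K : R, forall x, (`|h x| <= K)%R) ->
    exists f, stein_solution M C N h f }.

Record test_class M C N H : Prop := {
  test_measurable : forall g, H g ->
    measurable_fun [set: measurableTypeR R] (g : _ -> measurableTypeR R) ;
  test_integrable : forall g, H g ->
    P.-integrable [set: Omega] (EFin \o (g \o M)) ;
  test_unique_solution : forall g, H g -> exists! f, stein_solution M C N g f }.

(* Borel sets of R^2: the product sigma-algebra. *)
Notation R2 := (measurableTypeR R * measurableTypeR R)%type.

Definition separating (Ht : set (R * R -> R)) :=
  forall Q1 Q2 : probability R2 R,
    (forall h, Ht h -> Q1.-integrable [set: R2] (EFin \o h)) ->
    (forall h, Ht h -> Q2.-integrable [set: R2] (EFin \o h)) ->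
    (forall h, Ht h -> \int[Q1]_z (h z)%:E = \int[Q2]_z (h z)%:E) ->
    forall A : set R2, measurable A -> Q1 A = Q2 A.

Record test_class2 M Y H (Ht : set (R * R -> R)) : Prop := {
  test2_measurable : forall h, Ht h ->
    measurable_fun [set: R2] (h : R2 -> measurableTypeR R) ;
  test2_integrable : forall h, Ht h ->
    (distribution P M \x distribution P Y).-integrable [set: R2] (EFin \o h) ;
  test2_section : forall h, Ht h -> forall y : R, H (fun x => h (x, y)) ;
  test2_separating : separating Ht }.

Definition stein2 N (f : R * R -> R) (z : R * R) : R :=
  N (fun x => f (x, z.2)) z.1.

(* f_h(x,y) = f_{y,h}(x), where f_{y,h} is the solution in C of
   N f = h(., y) - E[h(M, y)]; it is unique when h(., y) is a test function.
   The default value [cst 0] is used only if there is no solution. *)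
Definition stein_solution2 M C N (h : R * R -> R) (z : R * R) : R :=
  xget (cst 0%R) [set f | stein_solution M C N (fun x => h (x, z.2)) f] z.1.

Record solution_class M C N (Ht Et : set (R * R -> R)) : Prop := {
  solution_section : forall f, Et f -> forall y : R, C (fun x => f (x, y)) ;
  solution_measurable : forall f, Et f ->
    measurable_fun [set: R2] (stein2 N f : R2 -> measurableTypeR R) ;
  solution_contains : forall h, Ht h -> Et (stein_solution2 M C N h) }.

End stein.

(* Main.v *)
Require Import Defs.
From HB Require Import structures.
From mathcomp Require Import all_boot all_order all_algebra.
From mathcomp Require Import all_classical all_reals all_analysis.
From mathcomp Require Import measurable_realfun.

(** Why the theorem holds. Both sides are equivalent to a statement about laws
    on R^2: the law Q of (X, Y) is the product of the law of M and the law of Y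
    ([joint_law_prodP]; M has law mu).

    If Q is this product, then E[N f (X, Y)] is the integral of the bounded
    function N f against it. By Fubini one may integrate over x first, and for
    fixed y the integral of N f(., y) against the law of M is 0, because
    f(., y) lies in the Stein class ([integral_stein_eq0]).

    Conversely, let h be a test function on R^2 and G(y) = E[h(M, y)]. The
    Stein equation for f_h ([stein2_solution2]) gives
      h(X, Y) = N f_h (X, Y) + G(Y).
    The first summand is bounded, and G(Y) is integrable because h is
    integrable for the product law ([integrable_fubini_G]); so h is
    Q-integrable, a fact that is not assumed but that the separating property
    demands. Taking expectations, the first summand contributes 0 by
    hypothesis and the second one the integral of h against the product law,
    by Fubini. So Q and the product law integrate all the test functions alike,
    and they coincide since the test functions are separating. *)

Set Implicit Arguments.
Unset Strict Implicit.
Unset Printing Implicit Defensive.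

Import Order.TTheory GRing.Theory Num.Theory.
Import numFieldNormedType.Exports.

Local Open Scope classical_set_scope.
Local Open Scope ring_scope.
Local Open Scope ereal_scope.

Section joint_law.
Context d d1 d2 (Omega : measurableType d) (T1 : measurableType d1)
  (T2 : measurableType d2) (R : realType) (P : probability Omega R).

Definition joint (X : {mfun Omega >-> T1}) (Y : {mfun Omega >-> T2}) w :=
  (X w, Y w).

HB.instance Definition _ (X : {mfun Omega >-> T1}) (Y : {mfun Omega >-> T2}) :=
  isMeasurableFun.Build _ _ _ _ (joint X Y)
    (measurable_fun_pair (measurable_funPT X) (measurable_funPT Y)).

Lemma integrable_distribution (X : {mfun Omega >-> T1}) (f : T1 -> \bar R) :
  measurable_fun [set: T1] f ->
  (distribution P X).-integrable setT f <-> P.-integrable setT (f \o X).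
Proof.
move=> mf; split => [/integrableP[_ foo]|]; last first.
  by move=> intf; apply: integrable_pushforward.
apply/integrableP; split; first exact: measurableT_comp.
by move: foo; rewrite ge0_integral_distribution//; exact: measurableT_comp.
Qed.

(** Rectangles determine a measure on the product, so the right-hand side
    gives the left-hand one; conversely the rectangle [A `*` setT] recovers the
    law of X, and then general rectangles express independence. *)
Lemma joint_law_prodP (X : {mfun Omega >-> T1}) (Y : {mfun Omega >-> T2})
    (m : probability T1 R) :
  (forall S, measurable S ->
     distribution P (joint X Y) S = (m \x distribution P Y) S) <->
  (forall A, measurable A -> distribution P X A = m A) /\
  (forall A B, measurable A -> measurable B ->
     P (X @^-1` A `&` Y @^-1` B) = P (X @^-1` A) * P (Y @^-1` B)).
Proof.
split=> [XY|[Xm XY] S mS]; last first.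
  apply/esym/product_measure_unique => // A B mA mB.
  transitivity (distribution P X A * distribution P Y B); first exact: XY.
  by rewrite Xm.
have prodE A B : measurable A -> measurable B ->
    P (X @^-1` A `&` Y @^-1` B) = m A * P (Y @^-1` B).
  move=> mA mB; rewrite -(product_measure1E m (distribution P Y))//.
  by rewrite -XY//; exact: measurableX.
have Xm A : measurable A -> distribution P X A = m A.
  move=> mA; have := prodE A setT mA measurableT.
  by rewrite !preimage_setT setIT probability_setT mule1.
by split=> // A B mA mB; rewrite prodE// -Xm.
Qed.

End joint_law.

(** The partial integral is dominated by that of [`|f|], whose total mass is
    finite by Tonelli. *)
Lemma integrable_fubini_G d1 d2 (T1 : measurableType d1)
    (T2 : measurableType d2) (R : realType)
    (m1 : {sigma_finite_measure set T1 -> \bar R})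
    (m2 : {sigma_finite_measure set T2 -> \bar R}) (f : T1 * T2 -> \bar R) :
  (m1 \x m2).-integrable setT f -> m2.-integrable setT (fubini_G m1 f).
Proof.
move=> intf; have mf := measurable_int _ intf.
apply/integrableP; split; first exact: (measurable_fubini_G intf).
apply: le_lt_trans ((integrable21ltyP _ _ mf).1 intf).
apply: ge0_le_integral => //.
- exact: measurableT_comp (measurable_fubini_G intf).
- apply: (measurable_fun_fubini_tonelli_G (abse \o f)); last first.
    by move=> z; exact: abse_ge0.
  exact: measurableT_comp mf.
- move=> y _; apply: le_abse_integral => //.
  by apply: measurableT_comp mf _.
Qed.

Lemma bounded_ereal_sup (R : realType) (T : Type) (g : T -> R) :
  ereal_sup (range (fun x => `|g x|%:E)) < +oo ->
  [bounded g x | x in [set: T]].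
Proof.
set s := ereal_sup _ => soo.
have gs x : `|g x|%:E <= s by apply: ereal_sup_ubound; exists x.
exists (fine s); split; first exact: num_real.
move=> K sK x _ /=; rewrite -lee_fin (le_trans (gs x))//.
case: s gs soo sK => [r|//|] gs _; first by rewrite lee_fin => /ltW.
by have := gs x.
Qed.

Section stein_equation.
Context d (Omega : measurableType d) (R : realType) (P : probability Omega R).
Variables (mu : probability (measurableTypeR R) R).
Variables (Y M : {RV P >-> measurableTypeR R}).
Variables (C : set (R -> R)) (N : (R -> R) -> (R -> R)).
Variables (H : set (R -> R)) (Ht : set (R * R -> R)).

(** M itself has law mu, so the characterization of mu applies to it. *)
Lemma integral_stein_eq0 f : stein_operator mu M C N -> has_law M mu -> C f ->
  \int[distribution P M]_x (N f x)%:E = 0.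
Proof.
move=> N_stein M_mu Cf.
have [intN] := (stein_characterization N_stein M).1 M_mu f Cf.
rewrite unlock => N0; rewrite integral_distribution//.
by apply/measurable_EFinP; exact: (stein_measurable N_stein).
Qed.

(** The Stein equation of h is written with h alone on the left, so that it
    reads as a decomposition of h; moving the expectation across is licit
    because it is finite for the sections of h. *)
Lemma stein2_solution2 h x y : test_class M C N H -> test_class2 M Y H Ht ->
  Ht h -> (h (x, y))%:E = (stein2 N (stein_solution2 M C N h) (x, y))%:E +
                          \int[distribution P M]_t (h (t, y))%:E.
Proof.
move=> H_test Ht_test Hth.
have Hhy := test2_section Ht_test Hth y.
have inth := test_integrable H_test Hhy.
have [f [solf _]] := test_unique_solution H_test Hhy.
have /xgetPex : exists f', stein_solution M C N (fun t => h (t, y)) f'.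
  by exists f.
move=> /(_ (cst 0%R))[_ /(_ x)]; rewrite /stein2 /stein_solution2/= => ->.
rewrite unlock [in RHS]integral_distribution//; last first.
  by apply/measurable_EFinP; exact: (test_measurable H_test Hhy).
by rewrite subeK//; exact: integrable_fin_num inth.
Qed.

End stein_equation.

Theorem theorem2p5 (d : measure_display) (Omega : measurableType d)
    (R : realType) (P : probability Omega R)
    (mu : probability (measurableTypeR R) R)
    (X Y M : {RV P >-> measurableTypeR R})
    (C : set (R -> R)) (N : (R -> R) -> (R -> R))
    (H : set (R -> R)) (Ht Et : set (R * R -> R))
    (M_mu : has_law M mu)
    (N_stein : stein_operator mu M C N)
    (H_test : test_class M C N H)
    (Ht_test : test_class2 M Y H Ht)
    (Et_sol : solution_class M C N Ht Et)
    (N_bounded : forall f, Et f ->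
       ereal_sup (range (fun z : R * R => (`|stein2 N f z|%R)%:E)) < +oo) :
  (has_law X mu /\ independent_RV X Y) <->
  (forall f, Et f -> 'E_P[fun w => stein2 N f (X w, Y w)] = 0).
Proof.
have lawE : (has_law X mu /\ independent_RV X Y) <->
    (forall S, measurable S ->
       distribution P (joint X Y) S = (distribution P M \x distribution P Y) S).
  rewrite joint_law_prodP; split=> -[Xmu XY]; split=> // A mA.
    exact: etrans (Xmu A mA) (esym (M_mu A mA)).
  exact: etrans (Xmu A mA) (M_mu A mA).
rewrite {}lawE.
have mNf f : Et f -> measurable_fun setT (EFin \o stein2 N f).
  by move=> Ef; apply/measurable_EFinP; exact: (solution_measurable Et_sol).
have intN (Q : probability (measurableTypeR R * measurableTypeR R)%type R) f :
    Et f -> Q.-integrable setT (EFin \o stein2 N f).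
  move=> Ef; apply: measurable_bounded_integrable => //.
  - by apply: le_lt_trans (probability_le1 Q _) (ltry 1).
  - exact: (solution_measurable Et_sol).
  - exact: bounded_ereal_sup (N_bounded _ Ef).
have intNXY f :
    Et f -> P.-integrable setT (EFin \o stein2 N f \o joint X Y).
  by move=> Ef; apply/integrable_distribution; [exact: mNf|exact: intN].
have EN f : Et f -> 'E_P[fun w => stein2 N f (X w, Y w)] =
    \int[distribution P (joint X Y)]_z (stein2 N f z)%:E.
  move=> Ef; rewrite unlock integral_distribution//; [exact: mNf|exact: intNXY].
split=> [law_prod f Ef|EN0].
  rewrite EN// (eq_measure_integral (distribution P M \x distribution P Y)).
    rewrite -integral21_prod_meas1; last exact: intN.
    apply: integral0_eq => y _.
    exact: (integral_stein_eq0 N_stein M_mu (solution_section Et_sol Ef y)).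
  by move=> A mA _; exact: law_prod.
pose G (h : R * R -> R) (y : R) : \bar R :=
  \int[distribution P M]_x (h (x, y))%:E.
have intG h : Ht h -> P.-integrable setT (G h \o Y).
  move=> Hh; have intG := integrable_fubini_G (test2_integrable Ht_test Hh).
  by apply/(integrable_distribution P Y _).1 => //; exact: measurable_int intG.
have hE h w : Ht h -> (h (X w, Y w))%:E =
    (stein2 N (stein_solution2 M C N h) (X w, Y w))%:E + G h (Y w).
  exact: stein2_solution2 H_test Ht_test.
have mh h : Ht h -> measurable_fun setT (EFin \o h).
  by move=> Hh; apply/measurable_EFinP; exact: (test2_measurable Ht_test).
have int_hXY h : Ht h -> P.-integrable setT (EFin \o h \o joint X Y).
  move=> Hh; have Ef := solution_contains Et_sol Hh.
  rewrite (_ : _ \o _ = (EFin \o stein2 N (stein_solution2 M C N h) \o joint X Y)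
     \+ (G h \o Y)); last by apply/funext => w; exact: hE.
  by apply: integrableD => //; [exact: intNXY|exact: intG].
apply: (test2_separating Ht_test) => h Hh.
- by apply/integrable_distribution; [exact: mh|exact: int_hXY].
- exact: (test2_integrable Ht_test).
have Ef := solution_contains Et_sol Hh.
rewrite integral_distribution; [|exact: mh|exact: int_hXY].
under eq_integral do rewrite /= hE//.
rewrite integralD//; [|exact: intNXY Ef|exact: intG].
have := EN0 _ Ef; rewrite unlock => ->; rewrite add0e.
have intGh := integrable_fubini_G (test2_integrable Ht_test Hh).
rewrite -(integral21_prod_meas1 (test2_integrable Ht_test Hh)).
by rewrite -(integral_distribution (measurable_int _ intGh) (intG _ Hh)).
Qed.
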